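(* Fix $n \in \mathbb{N}$. The number of numerical semigroups with exactly $n+1$ sporadic elements (counting $0$) and Frobenius number $f$ is, as a function of the positive integer $f$, a quasi-polynomial function of $f$ of degree $n$ with constant leading coefficient $1/(2^n\, n!)$ (i.e. each of the polynomials giving the function on the congruence classes has degree-$n$ coefficient equal to $1/(2^n\, n!)$, independently of the congruence class).
   Context: $\mathbb{N} = \{0,1,2,\ldots\}$. A numerical semigroup is a subset $S \subseteq \mathbb{N}$ with finite complement in $\mathbb{N}$ that contains $0$ and is closed under addition. The largest element of $\mathbb{N}\setminus S$ is the Frobenius number of $S$; the elements of $S$ less than its Frobenius number (including $0$) are the sporadic elements of $S$. A function $q$ is a quasi-polynomial if there is a positive integer modulus $K$ such that the restriction of $q$ to each congruence class modulo $K$ is given by a polynomial. The degree of a quasi-polynomial is the largest degree appearing among its associated polynomials. A function defined on positive integers is called quasi-polynomial if it agrees with a quasi-polynomial at all positive integers. *)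

(* Defs.v *)
From mathcomp Require Import all_boot all_order all_algebra.
From mathcomp Require Import boolp classical_sets functions cardinality.

Set Implicit Arguments.
Unset Strict Implicit.
Unset Printing Implicit Defensive.

Import Order.TTheory GRing.Theory Num.Theory.
Local Open Scope classical_set_scope.
Local Open Scope card_scope.
Local Open Scope nat_scope.

Definition numerical_semigroup (S : set nat) : Prop :=
  [/\ S 0, (forall a b, S a -> S b -> S (a + b)) & finite_set (~` S)].

(* A relation, because [setT] has no Frobenius number in [nat]. *)
Definition frobenius_number (S : set nat) (f : nat) : Prop :=
  ~ S f /\ forall m, ~ S m -> m <= f.

Definition sporadic (S : set nat) : set nat :=
  [set s | S s /\ exists2 f, frobenius_number S f & s < f].

Definition semigroups_with (k f : nat) : set (set nat) :=
  [set S | [/\ numerical_semigroup S, frobenius_number S f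
             & sporadic S #= `I_k]].

(* [p r] is the polynomial giving [q] on the congruence class of [r] modulo
   [K].  Rational coefficients lose nothing for integer-valued functions: a
   polynomial taking rational values on a congruence class is rational. *)
Definition quasi_polynomial_by (K : nat) (p : 'I_K -> {poly rat})
    (q : int -> rat) : Prop :=
  0 < K /\
  forall (r : 'I_K) (m : int),
    (m = (r : nat)%:Z %[mod K%:Z])%Z -> q m = ((p r).[m%:~R])%R.

(* Largest degree, with the zero polynomial counted as having degree 0. *)
Definition quasi_degree (K : nat) (p : 'I_K -> {poly rat}) : nat :=
  \max_(r < K) (size (p r)).-1.

Definition agrees_on_positive (N : nat -> nat) (q : int -> rat) : Prop :=
  forall f : nat, 0 < f -> ((N f)%:R = q f%:Z)%R.

(* Main.v *)
Require Import Defs.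
From mathcomp Require Import all_boot all_order all_algebra.
From mathcomp Require Import boolp classical_sets functions cardinality.
From mathcomp Require Import zify ring.

Import Order.TTheory GRing.Theory Num.Theory.
Local Open Scope classical_set_scope.
Local Open Scope card_scope.
Local Open Scope nat_scope.

(** Fix the Frobenius number [f > 0]. A semigroup with [n.+1] sporadic elements
    is determined by its positive sporadic elements [a_1 < ... < a_n < f], and
    such a sequence arises exactly when every sum [a_i + a_j] exceeds [f] or is
    some [a_k]. These conditions are Boolean combinations of homogeneous linear
    inequalities in [(a_1, ..., a_n, f)].

    Counting the integer solutions of a homogeneous system gives a
    quasi-polynomial at every [f > 0], with no exceptional small values. This
    is proved by eliminating one [a_i] at a time, as in Fourier-Motzkin
    elimination. The invariant is the class of piecewise quasi-polynomials
    [pw_quasipoly]: the algebra generated by quasi-polynomials of integer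
    linear forms and by the indicators of half-spaces [0 <= l]. The key lemma
    [pwq_sum_window] says that summing such a function over the integers [x]
    with [- v / a <= x <= u / b] ([u] and [v] linear forms in the other
    variables) stays in the class. Two facts make it work. When several bounds
    compete, which one is the tightest is decided by another homogeneous
    inequality. And the sum of a quasi-polynomial from [ceil (- v / a)] to
    [floor (u / b)] is a difference of values of its antidifference as soon as
    [- v / a <= u / b]: the interval may then contain no integer, but in that
    case the two values coincide. Homogeneity pays off at the end: when [f] is
    the only variable left, a half-space condition [0 <= c * f] does not depend
    on [f > 0], so the function is a quasi-polynomial on all positive integers
    ([pwq_univariate]).

    The leading coefficient comes from the size of the count. Any choice of
    [a_1 < ... < a_n] strictly between [f / 2] and [f] is admissible, which
    gives a binomial coefficient equivalent to [f ^ n / (2 ^ n * n!)]. In every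
    other admissible sequence the smallest entry satisfies [2 * a_1 <= f],
    hence [2 * a_1] is another entry, and there are only [O(f ^ (n - 1))] such
    sequences ([count_has_double]). A polynomial that stays within [O(f ^ (n -
    1))] of [f ^ n / (2 ^ n * n!)] along an infinite set has that leading term. *)

Set Implicit Arguments.
Unset Strict Implicit.

Local Open Scope ring_scope.

(** * Quasi-polynomials in one variable *)

Definition periodic (T : Type) (K : nat) (p : int -> T) : Prop :=
  forall x, p (x + K%:Z) = p x.

Lemma periodicMz (T : Type) (K : nat) (p : int -> T) (m x : int) :
  periodic K p -> p (x + m * K%:Z) = p x.
Proof.
move=> per.
have nonneg (j : nat) z : p (z + j%:Z * K%:Z) = p z.
  elim: j => [|j IH]; first by rewrite mul0r addr0.
  rewrite -[RHS]IH -[RHS]per; congr p; lia.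
case: m => j; first exact: nonneg.
rewrite -[LHS](nonneg j.+1); congr p; lia.
Qed.

Lemma periodic_eqmod (T : Type) (K : nat) (p : int -> T) (x y : int) :
  periodic K p -> (x = y %[mod K%:Z])%Z -> p x = p y.
Proof.
move=> per xy; rewrite (divz_eq x K%:Z) (divz_eq y K%:Z) xy.
by rewrite addrC periodicMz // addrC periodicMz.
Qed.

Lemma periodicM (T : Type) (K m : nat) (p : int -> T) :
  periodic K p -> periodic (m * K)%N p.
Proof. by move=> per x; rewrite PoszM periodicMz. Qed.

(** The polynomials are indexed by all integers, periodically, rather than by
    the residues: substitutions into [Q] then act on the index as they act on
    the variable, without any reduction modulo [K]. *)
Definition quasipoly (Q : int -> rat) : Prop :=
  exists2 K : nat, (0 < K)%N & exists2 p : int -> {poly rat},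
    periodic K p & forall x, Q x = (p x).[x%:~R].

Lemma quasipoly_horner (p : {poly rat}) : quasipoly (fun x => p.[x%:~R]).
Proof. by exists 1%N => //; exists (fun=> p). Qed.

Lemma quasipoly_const (c : rat) : quasipoly (fun=> c).
Proof. by exists 1%N => //; exists (fun=> c%:P) => // x; rewrite hornerC. Qed.

Lemma quasipoly_periodic (K : nat) (g : int -> rat) :
  (0 < K)%N -> periodic K g -> quasipoly g.
Proof.
move=> K0 per; exists K => //; exists (fun x => (g x)%:P).
  by move=> x; rewrite per.
by move=> x; rewrite hornerC.
Qed.

Lemma quasipolyD (P Q : int -> rat) :
  quasipoly P -> quasipoly Q -> quasipoly (fun x => P x + Q x).
Proof.
move=> [K K0 [p pper Pp]] [L L0 [q qper Qq]].
exists (K * L)%N; first by rewrite muln_gt0 K0.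
exists (fun x => p x + q x); last by move=> x; rewrite Pp Qq hornerD.
move=> x; congr (_ + _); last exact: (periodicM _ qper).
by rewrite mulnC; apply: (periodicM _ pper).
Qed.

Lemma quasipolyM (P Q : int -> rat) :
  quasipoly P -> quasipoly Q -> quasipoly (fun x => P x * Q x).
Proof.
move=> [K K0 [p pper Pp]] [L L0 [q qper Qq]].
exists (K * L)%N; first by rewrite muln_gt0 K0.
exists (fun x => p x * q x); last by move=> x; rewrite Pp Qq hornerM.
move=> x; congr (_ * _); last exact: (periodicM _ qper).
by rewrite mulnC; apply: (periodicM _ pper).
Qed.

Lemma quasipoly_sum (n : nat) (Q : nat -> int -> rat) :
  (forall i, quasipoly (Q i)) -> quasipoly (fun x => \sum_(i < n) Q i x).
Proof.
move=> qQ; elim: n => [|n IH].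
  rewrite (_ : (fun _ => _) = (fun=> 0)); first exact: quasipoly_const.
  by apply/funext => x; rewrite big_ord0.
rewrite (_ : (fun _ => _) = (fun x => (\sum_(i < n) Q i x) + Q n x)).
  exact: quasipolyD.
by apply/funext => x; rewrite big_ord_recr.
Qed.

Lemma quasipoly_affine (Q : int -> rat) (a b : int) :
  quasipoly Q -> quasipoly (fun x => Q (a * x + b)).
Proof.
move=> [K K0 [p pper Qp]]; exists K => //.
exists (fun x => p (a * x + b) \Po (a%:~R *: 'X + (b%:~R)%:P)) => x.
  by congr (_ \Po _); rewrite -(periodicMz a (a * x + b) pper); congr p; ring.
by rewrite Qp horner_comp !hornerE rmorphD rmorphM.
Qed.

Lemma quasipoly_divz (Q : int -> rat) (b : int) :
  0 < b -> quasipoly Q -> quasipoly (fun x => Q (x %/ b)%Z).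
Proof.
case: b => // b b0 [K K0 [p pper Qp]]; exists (b * K)%N.
  by rewrite muln_gt0 K0 andbT -ltz_nat.
have nzb : b%:Z != 0 by rewrite gt_eqF.
have nzb' : b%:R != 0 :> rat by rewrite pnatr_eq0 -lt0n -ltz_nat.
exists (fun x => p (x %/ b%:Z)%Z
          \Po (b%:R^-1 *: ('X - ((x %% b%:Z)%Z%:~R)%:P))) => x.
  have -> : x + (b * K)%N = K%:Z * b%:Z + x by rewrite PoszM; ring.
  by rewrite divzMDl // modzMDl [K%:Z + _]addrC pper.
rewrite Qp horner_comp !hornerE; congr (_.[_]).
rewrite [in X in _ = _ * (X - _)](divz_eq x b%:Z) rmorphD rmorphM /=.
by rewrite addrK mulrC mulfK.
Qed.

Lemma size_exp_XsubC_remainder (h : rat) (m : nat) :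
  (size (('X - h%:P) ^+ m.+1 - 'X^(m.+1) + (m.+1%:R * h) *: 'X^m : {poly rat})%R
     <= m)%N.
Proof.
elim: m => [|m IH].
  rewrite !expr1 expr0 mul1r alg_polyC (_ : _ + _ = 0) ?size_poly0 //; ring.
set E := (_ + _ : {poly rat}) in IH.
have -> : ('X - h%:P) ^+ m.+2 - 'X^(m.+2) + (m.+2%:R * h) *: 'X^(m.+1)
    = ('X - h%:P) * E + (m.+1%:R * h ^+ 2) *: 'X^m.
  rewrite /E -!mul_polyC -[m.+2%:R]natr1 expr2 !polyCM polyCD polyC1 !exprS; ring.
apply: (leq_trans (size_polyD _ _)); rewrite geq_max; apply/andP; split.
  apply: (leq_trans (size_polyMleq _ _)); rewrite size_XsubC; lia.
by apply: (leq_trans (size_scale_leq _ _)); rewrite size_polyXn.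
Qed.

(** Subtracting from [p] the difference of a multiple of ['X^m.+1] kills its
    coefficient of ['X^m]; the rest follows by induction on the degree. *)
Lemma poly_antidifference (h : rat) (p : {poly rat}) :
  h != 0 -> exists q : {poly rat}, forall x, q.[x] - q.[x - h] = p.[x].
Proof.
move=> h0; have [n] := ubnP (size p); elim: n p => // n IH p.
rewrite ltnS => szp.
case: n IH szp => [|m] IH szp.
  move: szp; rewrite leqn0 size_poly_eq0 => /eqP ->.
  by exists 0 => x; rewrite !hornerE.
set c := p`_m / (m.+1%:R * h).
have nn : m.+1%:R != 0 :> rat by rewrite pnatr_eq0.
pose q0 := c *: 'X^(m.+1).
have [|q Hq] := IH (p - (q0 - c *: ('X - h%:P) ^+ m.+1)).
  have -> : p - (q0 - c *: ('X - h%:P) ^+ m.+1) = (p - p`_m *: 'X^m)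
     + c *: (('X - h%:P) ^+ m.+1 - 'X^(m.+1) + (m.+1%:R * h) *: 'X^m).
    rewrite !scalerDr scalerA /c divfK ?mulf_neq0 // -/c /q0 scalerN; ring.
  rewrite ltnS; apply: (leq_trans (size_polyD _ _)); rewrite geq_max.
  apply/andP; split; last first.
    exact: leq_trans (size_scale_leq _ _) (size_exp_XsubC_remainder _ _).
  apply/leq_sizeP => j; rewrite leq_eqVlt coefB coefZ coefXn.
  case/orP => [/eqP <-|mj]; first by rewrite eqxx mulr1 subrr.
  by rewrite gtn_eqF // mulr0 subr0 nth_default // (leq_trans szp).
exists (q0 + q) => x; move: (Hq x).
rewrite /q0 !hornerE => H; rewrite opprD addrACA H; ring.
Qed.

(** On each residue class modulo the period [K] one needs an antidifference with
    step [K]; adding the values of these at [x], [x - 1], ..., [x - K + 1] gives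
    a sum whose difference with step 1 telescopes to a single difference with
    step [K]. *)
Lemma quasipoly_antidifference (Q : int -> rat) : quasipoly Q ->
  exists2 F : int -> rat, quasipoly F & forall x, F x - F (x - 1) = Q x.
Proof.
move=> [K K0 [p pper Qp]].
have nzK : K%:R != 0 :> rat by rewrite pnatr_eq0 -lt0n.
have [q Hq] := choice (fun r : {poly rat} => poly_antidifference r nzK).
pose g (x : int) := (q (p x)).[x%:~R].
have qg : quasipoly g.
  by exists K => //; exists (fun x => q (p x)) => // x; rewrite pper.
exists (fun x => \sum_(i < K) g (1 * x + (- i%:Z))).
  exact: (quasipoly_sum K (fun i => quasipoly_affine 1 (- i%:Z) qg)).
move=> x; rewrite -sumrB.
have tele n : \sum_(i < n) (g (1 * x - i%:Z) - g (1 * (x - 1) - i%:Z))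
    = g x - g (x - n%:Z).
  elim: n => [|n IH]; first by rewrite big_ord0 subr0 subrr.
  rewrite big_ord_recr /= IH !mul1r.
  have -> : x - 1 - n%:Z = x - n.+1%:Z by lia.
  ring.
rewrite tele /g.
have E : p (x - K%:Z) = p x by rewrite -pper subrK.
by rewrite E intrB Hq Qp.
Qed.

(** This separates the variables in a quasi-polynomial of a linear form: for
    [w] in a fixed residue class, expand the polynomial at [z + w] by Taylor's
    formula in powers of [w]. *)
Lemma quasipoly_addition (Q : int -> rat) : quasipoly Q ->
  exists (I : finType) (A B : I -> int -> rat),
    [/\ forall i, quasipoly (A i), forall i, quasipoly (B i)
      & forall z w, Q (z + w) = \sum_i A i z * B i w].
Proof.
move=> [K K0 [p pper Qp]].
pose d := \max_(s < K) size (p s%:Z).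
have szp x : (size (p x) <= d)%N.
  have lt : (`|(x %% K%:Z)%Z| < K)%N.
    by have := ltz_pmod x (d := K%:Z); have := modz_ge0 x (d := K%:Z); lia.
  rewrite (@periodic_eqmod _ K p x (Ordinal lt)) //; first exact: leq_bigmax.
  by rewrite /= gez0_abs ?modz_ge0 ?modz_mod //; lia.
exists ('I_K * 'I_d)%type,
  (fun (i : 'I_K * 'I_d) (z : int) => (p (z + (i.1 : nat)%:Z))^`N(i.2).[z%:~R]),
  (fun (i : 'I_K * 'I_d) (w : int) =>
     (w == (i.1 : nat)%:Z %[mod K%:Z])%Z%:R * w%:~R ^+ i.2).
split=> [i|i|z w].
- exists K => //; exists (fun z => (p (z + (i.1 : nat)%:Z))^`N(i.2)) => // x.
  by rewrite addrAC pper.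
- apply: quasipolyM.
    by apply: (@quasipoly_periodic K) => // x; rewrite modzDr.
  rewrite (_ : (fun _ => _) = (fun x => ('X^(i.2) : {poly rat}).[x%:~R])).
    exact: quasipoly_horner.
  by apply/funext => x; rewrite hornerXn.
have lt : (`|(w %% K%:Z)%Z| < K)%N.
  by have := ltz_pmod w (d := K%:Z); have := modz_ge0 w (d := K%:Z); lia.
have absw : (`|(w %% K%:Z)%Z|%N%:Z = w %[mod K%:Z])%Z.
  by rewrite gez0_abs ?modz_ge0 ?modz_mod //; lia.
rewrite -(pair_bigA _ (fun (s : 'I_K) (j : 'I_d) =>
  (p (z + (s : nat)%:Z))^`N(j).[z%:~R] *
  ((w == (s : nat)%:Z %[mod K%:Z])%Z%:R * w%:~R ^+ j))) /=.
rewrite (bigD1 (Ordinal lt)) //= [X in _ = _ + X]big1 ?addr0; last first.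
  move=> s ne; rewrite big1 // => j _.
  rewrite (_ : (_ == _)%Z = false) ?mul0r ?mulr0 //.
  apply/negP => /eqP E; case/eqP: ne; apply: val_inj => /=; rewrite E.
  by rewrite modz_small //; have := ltn_ord s; lia.
rewrite Qp intrD (nderiv_taylor_wide (mulrC _ _) (szp _)).
apply: eq_bigr => j _; rewrite absw eqxx mul1r; congr (_^`N(_).[_] * _).
apply: (periodic_eqmod pper).
by rewrite -modzDmr -[in RHS]modzDmr absw.
Qed.

(** * Piecewise quasi-polynomials and elimination of a variable *)

Definition linform (k : nat) (c : nat -> int) (y : seq int) : int :=
  \sum_(i < k) c i * y`_i.

Lemma linform_cons (k : nat) (c : nat -> int) (x : int) (y : seq int) :
  linform k.+1 c (x :: y) = c 0%N * x + linform k (fun i => c i.+1) y.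
Proof. by rewrite /linform big_ord_recl. Qed.

Lemma linform_lin (k : nat) (a b : int) (c d : nat -> int) (y : seq int) :
  linform k (fun i => a * c i + b * d i) y =
  a * linform k c y + b * linform k d y.
Proof.
rewrite /linform !mulr_sumr -big_split /=; apply: eq_bigr => i _.
by rewrite mulrDl !mulrA.
Qed.

Lemma linform_coord (k i : nat) (y : seq int) :
  (i < k)%N -> linform k (fun j => (j == i)%:Z) y = y`_i.
Proof.
move=> ik; rewrite /linform (bigD1 (Ordinal ik)) //= eqxx mul1r big1 ?addr0 //.
by move=> j ne; rewrite (_ : (_ == _) = false) ?mul0r //; apply/negbTE.
Qed.

(** The two product constructors multiply by one generator at a time, so that
    an induction over the class only ever has to absorb one generator. *)
Inductive pw_quasipoly (k : nat) : (seq int -> rat) -> Prop :=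
| pwq_const a : pw_quasipoly k (fun=> a)
| pwq_add G H : pw_quasipoly k G -> pw_quasipoly k H ->
    pw_quasipoly k (fun y => G y + H y)
| pwq_quasi Q c G : quasipoly Q -> pw_quasipoly k G ->
    pw_quasipoly k (fun y => Q (linform k c y) * G y)
| pwq_cone c G : pw_quasipoly k G ->
    pw_quasipoly k (fun y => (0 <= linform k c y)%R%:R * G y).

Lemma pwq_scale k a G : pw_quasipoly k G -> pw_quasipoly k (fun y => a * G y).
Proof. by move=> /(pwq_quasi (fun=> 0) (quasipoly_const a)). Qed.

Lemma pwq_mul k G H : pw_quasipoly k G -> pw_quasipoly k H ->
  pw_quasipoly k (fun y => G y * H y).
Proof.
move=> pG pH; elim: pG => [a|G1 G2 _ IH1 _ IH2|Q c G1 qQ _ IH|c G1 _ IH].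
- exact: pwq_scale.
- rewrite (_ : (fun _ => _) = (fun y => G1 y * H y + G2 y * H y)); last first.
    by apply/funext => y; rewrite mulrDl.
  exact: pwq_add.
- rewrite (_ : (fun _ => _) = (fun y => Q (linform k c y) * (G1 y * H y))).
    exact: pwq_quasi.
  by apply/funext => y; rewrite mulrA.
- rewrite (_ : (fun _ => _) =
    (fun y => (0 <= linform k c y)%R%:R * (G1 y * H y))).
    exact: pwq_cone.
  by apply/funext => y; rewrite mulrA.
Qed.

Lemma pwq_form k Q c :
  quasipoly Q -> pw_quasipoly k (fun y => Q (linform k c y)).
Proof.
move=> qQ; rewrite (_ : (fun _ => _) = (fun y => Q (linform k c y) * 1)).
  exact: pwq_quasi (pwq_const _ _).
by apply/funext => y; rewrite mulr1.
Qed.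

Lemma pwq_sum k (I : finType) (G : I -> seq int -> rat) :
  (forall i, pw_quasipoly k (G i)) -> pw_quasipoly k (fun y => \sum_i G i y).
Proof.
move=> pG; elim: (index_enum I) => [|i s IH].
  rewrite (_ : (fun _ => _) = (fun=> 0)); first exact: pwq_const.
  by apply/funext => y; rewrite big_nil.
rewrite (_ : (fun _ => _) = (fun y => G i y + \sum_(j <- s) G j y)).
  exact: pwq_add.
by apply/funext => y; rewrite big_cons.
Qed.

(** The sign of a linear form tells which of two competing bounds is effective,
    and with it which of two results applies. *)
Lemma pwq_switch k d R S : pw_quasipoly k R -> pw_quasipoly k S ->
  pw_quasipoly k (fun y => (0 <= linform k d y)%R%:R * R y +
    (1 + -1 * (0 <= linform k d y)%R%:R) * S y).
Proof.
move=> pR pS; apply: pwq_add; first exact: pwq_cone.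
apply: pwq_mul => //; apply: pwq_add; first exact: pwq_const.
apply: pwq_scale; rewrite (_ : (fun _ => _) =
  (fun y => (0 <= linform k d y)%R%:R * 1)); first exact/pwq_cone/pwq_const.
by apply/funext => y; rewrite mulr1.
Qed.

Lemma le_bound_trans (a c v w t : int) :
  0 < a -> 0 < c -> c * v <= a * w -> a * t <= v -> c * t <= w.
Proof.
move=> a0 c0 vw tv; rewrite -(ler_pM2l a0); apply: le_trans vw.
by rewrite mulrCA ler_pM2l.
Qed.

(** Summing over the members of an arbitrary sequence [s] that contains the
    interval avoids naming an enumeration of an interval of integers. *)
Lemma sum_int_telescope (F Q : int -> rat) (A : int) (n : nat) (s : seq int) :
  (forall x, F x - F (x - 1) = Q x) -> uniq s ->
  (forall x, A < x <= A + n%:Z -> x \in s) ->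
  \sum_(x <- s | A < x <= A + n%:Z) Q x = F (A + n%:Z) - F A.
Proof.
move=> FQ us; elim: n => [|n IH] sub.
  rewrite addr0 subrr big1 // => x; lia.
have mem : A + n.+1%:Z \in s by apply: sub; lia.
rewrite (bigID (pred1 (A + n.+1%:Z))) /= addrC.
rewrite (eq_bigl (fun x => A < x <= A + n%:Z)); last by move=> x /=; lia.
rewrite [X in _ + X](eq_bigl (pred1 (A + n.+1%:Z))); last by move=> x /=; lia.
rewrite [X in _ + X]big_mkcond [X in _ + X](bigD1_seq (A + n.+1%:Z)) //= eqxx.
rewrite [X in _ + (_ + X)]big1 ?addr0; last by move=> x /negbTE ->.
rewrite IH; last by move=> x xA; apply: sub; lia.
rewrite -FQ (_ : A + n.+1%:Z - 1 = A + n%:Z); [ring | lia].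
Qed.

(** The integer points of the interval from [- v / a] to [u / b]; the lower
    bound is written as an upper bound on [- x], so that floors suffice and both
    ends are handled by the same inequalities. *)
Definition window (k : nat) (a b : int) (v u : nat -> int) (y : seq int)
    (x : int) : bool :=
  (a * - x <= linform k v y) && (b * x <= linform k u y).

(** The additional factor [Q x] and the window are what the generators turn into
    when they are absorbed: a quasi-polynomial of [c 0 * x + l y] splits by
    [quasipoly_addition] into factors merged with [Q] and factors independent of
    [x], and a half-space in which [x] occurs is a bound on [x], which competes
    with one end of the window.  Only the constants have to be summed. *)
Lemma pwq_sum_window (k : nat) (G : seq int -> rat) :
  pw_quasipoly k.+1 G ->
  forall (Q : int -> rat) (a b : int) (v u : nat -> int),
    quasipoly Q -> 0 < a -> 0 < b ->
  exists2 R, pw_quasipoly k R & forall (y s : seq int), uniq s ->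
    (forall x, window k a b v u y x -> x \in s) ->
    \sum_(x <- s | window k a b v u y x) Q x * G (x :: y) = R y.
Proof.
elim=> [t|G1 G2 _ IH1 _ IH2|Q' c G1 qQ' _ IH|c G1 _ IH] Q a b v u qQ a0 b0.
- have [F qF FQ] := quasipoly_antidifference qQ.
  pose FB x := F (x %/ b)%Z; pose FA x := F (- 1 * (x %/ a)%Z - 1).
  exists (fun y => (0 <= linform k (fun i => a * u i + b * v i) y)%R%:R *
    ((FB (linform k u y) + -1 * FA (linform k v y)) * t)).
    apply/pwq_cone/pwq_mul; last exact: pwq_const.
    apply: pwq_add; [|apply: pwq_scale]; apply: pwq_form.
      exact: quasipoly_divz.
    exact: (quasipoly_divz a0 (quasipoly_affine (- 1) (- 1) qF)).
  move=> y s us; set P := window k a b v u y => sub.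
  rewrite -mulr_suml mulrA; congr (_ * t).
  rewrite linform_lin mulN1r /FA /FB mulN1r.
  set U := linform k u y; set V := linform k v y.
  have PE x : P x = (- (V %/ a)%Z - 1 < x <= (U %/ b)%Z).
    rewrite /P /window -/U -/V [a * _]mulrC [b * _]mulrC -!lez_divRL // lerNl.
    by rewrite ltrBlDr ltzD1.
  have [nonneg|neg] := lerP 0 (a * U + b * V); last first.
    rewrite mul0r big1 // => x /andP[xv xu].
    have : a * (b * x) <= a * U by rewrite ler_pM2l.
    have : b * (a * - x) <= b * V by rewrite ler_pM2l.
    have : a * (b * x) = - (b * (a * - x)) by ring.
    by move: neg; clear; lia.
  (* The interval is nonempty over the rationals, so that its integer ends are
     out of order by at most one. *)
  have : - (V %/ a)%Z - 1 <= (U %/ b)%Z.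
    rewrite leNgt; apply/negP => lt.
    have Ub : a * U < a * (((U %/ b)%Z + 1) * b) by rewrite ltr_pM2l ?ltz_ceil.
    have Va : b * V < b * (((V %/ a)%Z + 1) * a) by rewrite ltr_pM2l ?ltz_ceil.
    have : a * b * ((U %/ b)%Z + (V %/ a)%Z + 2) <= 0.
      by rewrite pmulr_rle0 ?mulr_gt0 //; move: lt; clear; lia.
    have -> : a * b * ((U %/ b)%Z + (V %/ a)%Z + 2) =
      a * (((U %/ b)%Z + 1) * b) + b * (((V %/ a)%Z + 1) * a) by ring.
    by move: Ub Va nonneg; clear; lia.
  move: PE sub; set B := (U %/ b)%Z; set A := - (V %/ a)%Z - 1 => PE sub AB.
  have BE : B = A + `|B - A|%N%:Z by move: AB; clear; lia.
  rewrite mul1r (eq_bigl _ _ PE) BE (sum_int_telescope FQ us) //.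
  by move=> x; rewrite -BE -PE; apply: sub.
- have [R1 p1 H1] := IH1 Q a b v u qQ a0 b0.
  have [R2 p2 H2] := IH2 Q a b v u qQ a0 b0.
  exists (fun y => R1 y + R2 y); first exact: pwq_add.
  move=> y s us sub; rewrite -(H1 y s us sub) -(H2 y s us sub) -big_split /=.
  by apply: eq_bigr => x _; rewrite mulrDr.
- have [I [A [B [qA qB AB]]]] := quasipoly_addition qQ'.
  have RP i : exists R, pw_quasipoly k R /\ forall (y s : seq int), uniq s ->
    (forall x, window k a b v u y x -> x \in s) ->
    \sum_(x <- s | window k a b v u y x) (Q x * A i (c 0%N * x + 0)) * G1 (x :: y) = R y.
    have [|R pR HR] := IH (fun x => Q x * A i (c 0%N * x + 0)) a b v u _ a0 b0.
      exact: quasipolyM (quasipoly_affine _ _ (qA i)).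
    by exists R.
  have {}[R HR] := choice RP.
  exists (fun y => \sum_i B i (linform k (fun j => c j.+1) y) * R i y).
    by apply: pwq_sum => i; apply: pwq_quasi => //; case: (HR i).
  move=> y s us; set P := window k a b v u y => sub.
  rewrite (eq_bigr (fun i => \sum_(x <- s | P x)
     Q x * (A i (c 0%N * x) * B i (linform k (fun j => c j.+1) y) * G1 (x :: y)))).
    rewrite exchange_big /=; apply: eq_bigr => x _.
    by rewrite linform_cons AB mulr_suml mulr_sumr.
  move=> i _; have [_ /(_ y s us sub) <-] := HR i.
  by rewrite mulr_sumr; apply: eq_bigr => x _; rewrite addr0; ring.
- set w := fun i => c i.+1.
  have [R0 p0 H0] := IH Q a b v u qQ a0 b0.
  have mid y s (P : pred int) : (forall x, P x -> 0 <= linform k.+1 c (x :: y)) ->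
    \sum_(x <- s | P x) Q x * ((0 <= linform k.+1 c (x :: y))%R%:R * G1 (x :: y))
    = \sum_(x <- s | P x) Q x * G1 (x :: y).
    move=> H; apply: eq_bigr => x /H ->; by rewrite mul1r.
  have [c0|c0|c0] := ltgtP (c 0%N) 0.
  + (* an upper bound on x *)
    have nc0 : 0 < - c 0%N by rewrite oppr_gt0.
    have [R1 p1 H1] := IH Q a (- c 0%N) v w qQ a0 nc0.
    pose d i := b * w i + c 0%N * u i.
    exists (fun y => (0 <= linform k d y)%R%:R * R0 y +
        (1 + -1 * (0 <= linform k d y)%R%:R) * R1 y).
      exact: pwq_switch.
    move=> y s us; set P := window k a b v u y => sub; rewrite linform_lin.
    case: (lerP 0 _) => dy.
      rewrite mulN1r subrr mul0r addr0 mul1r -(H0 y s us sub) mid //.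
      move=> x /andP[_ xu]; rewrite linform_cons -/w.
      have : - c 0%N * x <= linform k w y by apply: le_bound_trans xu => //; lia.
      lia.
    rewrite mul0r mulr0 addr0 mul1r add0r -(H1 y s us); last first.
      move=> x /andP[xv xw]; apply: sub; rewrite /P /window xv /=.
      by apply: le_bound_trans xw => //; lia.
    rewrite big_mkcond [RHS]big_mkcond; apply: eq_bigr => x _.
    rewrite /P /window; case: (a * - x <= _) => //=.
    rewrite linform_cons -/w.
    have -> : (0 <= c 0%N * x + linform k w y) = (- c 0%N * x <= linform k w y).
      lia.
    case: (boolP (- c 0%N * x <= _)) => xw.
      by rewrite mul1r (le_bound_trans _ _ _ xw) //; lia.
    by rewrite mul0r mulr0; case: ifP.
  + (* a lower bound on x *)
    have [R1 p1 H1] := IH Q (c 0%N) b w u qQ c0 b0.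
    pose d i := a * w i + (- c 0%N) * v i.
    exists (fun y => (0 <= linform k d y)%R%:R * R0 y +
        (1 + -1 * (0 <= linform k d y)%R%:R) * R1 y).
      exact: pwq_switch.
    move=> y s us; set P := window k a b v u y => sub; rewrite linform_lin.
    case: (lerP 0 _) => dy.
      rewrite mulN1r subrr mul0r addr0 mul1r -(H0 y s us sub) mid //.
      move=> x /andP[xv _]; rewrite linform_cons -/w.
      have : c 0%N * - x <= linform k w y by apply: le_bound_trans xv => //; lia.
      lia.
    rewrite mul0r mulr0 addr0 mul1r add0r -(H1 y s us); last first.
      move=> x /andP[xw xu]; apply: sub; rewrite /P /window xu andbT.
      by apply: le_bound_trans xw => //; lia.
    rewrite big_mkcond [RHS]big_mkcond; apply: eq_bigr => x _.
    rewrite /P /window andbC [in RHS]andbC; case: (b * x <= _) => //=.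
    rewrite linform_cons -/w.
    have -> : (0 <= c 0%N * x + linform k w y) = (c 0%N * - x <= linform k w y).
      lia.
    case: (boolP (c 0%N * - x <= _)) => xw.
      by rewrite mul1r (le_bound_trans _ _ _ xw) //; lia.
    by rewrite mul0r mulr0; case: ifP.
  + exists (fun y => (0 <= linform k w y)%R%:R * R0 y); first exact: pwq_cone.
    move=> y s us sub; rewrite -(H0 y s us sub) mulr_sumr.
    by apply: eq_bigr => x _; rewrite linform_cons c0 mul0r add0r; ring.
Qed.

(** For [f > 0] the sign of [c * f] is that of [c]: the pieces disappear. *)
Lemma pwq_univariate (G : seq int -> rat) : pw_quasipoly 1 G ->
  exists2 Q, quasipoly Q & forall f : nat, (0 < f)%N -> G [:: f%:Z] = Q f%:Z.
Proof.
have form1 c (z : int) : linform 1 c [:: z] = c 0%N * z + 0.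
  by rewrite /linform big_ord1 addr0.
elim=> [a|G1 G2 _ [Q1 q1 H1] _ [Q2 q2 H2]|Q c G1 qQ _ [Q1 q1 H1]|c G1 _ [Q1 q1 H1]].
- by exists (fun=> a) => //; apply: quasipoly_const.
- exists (fun x => Q1 x + Q2 x); first exact: quasipolyD.
  by move=> f f0; rewrite H1 // H2.
- exists (fun x => Q (c 0%N * x + 0) * Q1 x).
    exact: quasipolyM (quasipoly_affine _ _ qQ) q1.
  by move=> f f0; rewrite H1 // form1.
- exists (fun x => (0 <= c 0%N)%R%:R * Q1 x).
    exact: quasipolyM (quasipoly_const _) q1.
  by move=> f f0; rewrite H1 // form1 addr0 pmulr_lge0.
Qed.

(** * Counting the integer points of a homogeneous system *)

Fixpoint words (n f : nat) : seq (seq nat) :=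
  if n is m.+1 then [seq x :: s | x <- iota 0 f.+1, s <- words m f]
  else [:: [::]].

Lemma wordsS n f :
  words n.+1 f = [seq x :: s | x <- iota 0 f.+1, s <- words n f].
Proof. by []. Qed.

Lemma mem_words n f s :
  (s \in words n f) = (size s == n) && all (fun x => x <= f)%N s.
Proof.
elim: n s => [|n IH] s; first by case: s.
rewrite wordsS; apply/allpairsP/idP => [[[y t]]|].
  rewrite (mem_iota 0 f.+1) add0n ltnS IH /= => -[yf /andP[/eqP <- tf] ->].
  by rewrite /= eqxx yf.
case: s => [|x s] //=; rewrite eqSS => /and3P[ns xf sf].
by exists (x, s); rewrite (mem_iota 0 f.+1) add0n ltnS IH ns.
Qed.

Lemma words_uniq n f : uniq (words n f).
Proof.
elim: n => // n IH; apply: (allpairs_uniq (iota_uniq 0 f.+1) IH).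
by move=> [x s] [y t] _ _ [-> ->].
Qed.

Lemma big_words_cons (R : nmodType) n f (F : seq nat -> R) :
  \sum_(s <- words n.+1 f) F s
  = \sum_(t <- words n f) \sum_(x <- iota 0 f.+1) F (x :: t).
Proof. by rewrite big_allpairs_dep exchange_big. Qed.

(** The parameter [f] is the last variable, so that the summation variables are
    eliminated from the front and [f] alone remains. *)
Lemma pwq_sum_words n (G : seq int -> rat) : pw_quasipoly n.+1 G ->
  exists2 Q, quasipoly Q & forall f : nat, (0 < f)%N ->
    \sum_(s <- words n f) G (map Posz (rcons s f)) = Q f%:Z.
Proof.
elim: n G => [|n IH] G pG.
  have [Q qQ HQ] := pwq_univariate pG; exists Q => // f f0.
  by rewrite big_seq1 HQ.
have [R pR HR] := pwq_sum_window pG (fun=> 0) (fun j => (j == n)%:Z)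
  (quasipoly_const 1) ltr01 ltr01.
have [Q qQ HQ] := IH R pR; exists Q => // f f0; rewrite -HQ // big_words_cons.
apply: eq_big_seq => t; rewrite mem_words => /andP[/eqP szt _].
pose y := map Posz (rcons t f).
have E : linform n.+1 (fun j => (j == n)%:Z) y = f%:Z.
  rewrite linform_coord // (nth_map 0%N) ?size_rcons ?szt //.
  by rewrite nth_rcons szt ltnn eqxx.
have E0 : linform n.+1 (fun=> 0) y = 0.
  by rewrite /linform big1 // => i _; rewrite mul0r.
rewrite -(HR y (map Posz (iota 0 f.+1))).
- rewrite big_map [RHS]big_mkcond; apply: eq_big_seq => x.
  rewrite /window E E0 (mem_iota 0 f.+1) !mul1r oppr_le0 lez_nat /=.
  by rewrite add0n ltnS => ->.
- by rewrite map_inj_uniq ?iota_uniq // => ? ? [].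
- move=> x; rewrite /window E E0 !mul1r => /andP[x0 xf].
  apply/mapP; exists `|x|%N; last by lia.
  by rewrite (mem_iota 0 f.+1); lia.
Qed.

(** Agreement with the indicator is asked for at natural numbers only, which
    allows conditions to be stated with the arithmetic of [nat]. *)
Definition definable (n : nat) (b : seq nat -> nat -> bool) : Prop :=
  exists2 G, pw_quasipoly n.+1 G & forall s f, size s = n ->
    G (map Posz (rcons s f)) = (b s f)%:R.

Definition linear_term (n : nat) (t : seq nat -> nat -> nat) : Prop :=
  exists c, forall s f, size s = n ->
    (t s f)%:Z = linform n.+1 c (map Posz (rcons s f)).

Lemma linear_term_nth n i :
  (i <= n)%N -> linear_term n (fun s f => nth 0%N (rcons s f) i).
Proof.
move=> le; exists (fun j => (j == i)%:Z) => s f szs.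
by rewrite linform_coord // (nth_map 0%N) ?size_rcons ?szs.
Qed.

Lemma linear_term0 n : linear_term n (fun _ _ => 0%N).
Proof.
by exists (fun=> 0) => s f _; rewrite /linform big1 // => i _; rewrite mul0r.
Qed.

Lemma linear_termD n t u : linear_term n t -> linear_term n u ->
  linear_term n (fun s f => t s f + u s f)%N.
Proof.
move=> [c Hc] [d Hd]; exists (fun i => 1 * c i + 1 * d i) => s f szs.
by rewrite linform_lin !mul1r PoszD Hc // Hd.
Qed.

Lemma definable_ext n b b' : (forall s f, size s = n -> b s f = b' s f) ->
  definable n b -> definable n b'.
Proof. by move=> E [G pG HG]; exists G => // s f szs; rewrite HG // E. Qed.

Lemma definable_le n t u : linear_term n t -> linear_term n u ->
  definable n (fun s f => t s f <= u s f)%N.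
Proof.
move=> [c Hc] [d Hd].
exists (fun y => (0 <= linform n.+1 (fun i => 1 * d i + (- 1) * c i) y)%R%:R * 1).
  exact/pwq_cone/pwq_const.
move=> s f szs; rewrite linform_lin mulr1 mul1r mulN1r -Hc // -Hd // subr_ge0.
by rewrite lez_nat.
Qed.

Lemma definableN n b : definable n b -> definable n (fun s f => ~~ b s f).
Proof.
move=> [G pG HG]; exists (fun y => 1 + -1 * G y).
  exact: pwq_add (pwq_const _ _) (pwq_scale _ pG).
by move=> s f szs; rewrite HG //; case: (b s f).
Qed.

Lemma definable_and n b c : definable n b -> definable n c ->
  definable n (fun s f => b s f && c s f).
Proof.
move=> [G pG HG] [H pH HH]; exists (fun y => G y * H y); first exact: pwq_mul.
by move=> s f szs; rewrite HG // HH // mulrb; case: (b s f); rewrite ?mul1r ?mul0r.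
Qed.

Lemma definable_or n b c : definable n b -> definable n c ->
  definable n (fun s f => b s f || c s f).
Proof.
move=> db dc; apply: (@definable_ext n (fun s f => ~~ (~~ b s f && ~~ c s f))).
  by move=> s f _; rewrite negb_and !negbK.
by do 2![apply: definableN || apply: definable_and]; apply: definableN.
Qed.

Lemma definable_all n (r : seq nat) b : (forall i, i \in r -> definable n (b i)) ->
  definable n (fun s f => all (fun i => b i s f) r).
Proof.
elim: r => [|i r IH] db /=.
  by exists (fun=> 1) => //; apply: pwq_const.
apply: definable_and; first by apply: db; rewrite mem_head.
by apply: IH => j jr; apply: db; rewrite inE jr orbT.
Qed.

Lemma definable_has n (r : seq nat) b : (forall i, i \in r -> definable n (b i)) ->
  definable n (fun s f => has (fun i => b i s f) r).
Proof.
move=> db; apply: (@definable_ext n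
  (fun s f => ~~ all (fun i => ~~ b i s f) r)).
  by move=> s f _; rewrite -has_predC; apply: eq_has => i /=; rewrite negbK.
by apply/definableN/definable_all => i /db; apply: definableN.
Qed.

Lemma definable_lt n t u : linear_term n t -> linear_term n u ->
  definable n (fun s f => t s f < u s f)%N.
Proof.
move=> lt lu; apply: (@definable_ext n (fun s f => ~~ (u s f <= t s f)%N)).
  by move=> s f _; rewrite -ltnNge.
exact/definableN/definable_le.
Qed.

Lemma definable_eq n t u : linear_term n t -> linear_term n u ->
  definable n (fun s f => t s f == u s f)%N.
Proof.
move=> lt lu; apply: (@definable_ext n
  (fun s f => (t s f <= u s f) && (u s f <= t s f))%N).
  by move=> s f _; rewrite -eqn_leq.
by apply: definable_and; apply: definable_le.
Qed.

Close Scope ring_scope.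

(** * Semigroups as admissible sequences *)

(** The conditions under which [0], the entries of [s] and the integers above
    [f] form a semigroup with Frobenius number [f]. *)
Definition admissible (f : nat) (s : seq nat) : bool :=
  path ltn 0 (rcons s f) &&
  all (fun a => all (fun b => (f < a + b) || (a + b \in s)) s) s.

Lemma all_nth_iota (T : Type) (x0 : T) (p : pred T) (s : seq T) :
  all p s = all (fun i => p (nth x0 s i)) (iota 0 (size s)).
Proof. by rewrite -{1}(mkseq_nth x0 s) /mkseq all_map. Qed.

Lemma has_nth_iota (T : Type) (x0 : T) (p : pred T) (s : seq T) :
  has p s = has (fun i => p (nth x0 s i)) (iota 0 (size s)).
Proof. by rewrite -{1}(mkseq_nth x0 s) /mkseq has_map. Qed.

(** With the length of [s] fixed, all quantifiers over the entries of [s] become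
    finite conjunctions and disjunctions over positions. *)
Lemma definable_admissible n : definable n (fun s f => admissible f s).
Proof.
pose e (s : seq nat) f i := nth 0 (rcons s f) i.
pose pred_e s f i := if i is j.+1 then e s f j else 0.
apply: (@definable_ext n (fun s f =>
   all (fun i => pred_e s f i < e s f i) (iota 0 n.+1) &&
   all (fun i => all (fun j => (e s f n < e s f i + e s f j) ||
     has (fun k => e s f i + e s f j == e s f k) (iota 0 n)) (iota 0 n))
     (iota 0 n))).
  move=> s f szs; have nthe i : i \in iota 0 n -> e s f i = nth 0 s i.
    by rewrite mem_iota add0n /e nth_rcons szs => /= ->.
  congr (_ && _).
    apply/allP/(pathP 0) => H i.
      rewrite size_rcons szs => lt; have := H i; rewrite mem_iota => /(_ lt).
      by case: i lt.
    rewrite mem_iota /= add0n => lt; have := H i; rewrite size_rcons szs => /(_ lt).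
    by case: i lt.
  rewrite [RHS](all_nth_iota 0) szs; apply: eq_in_all => i /nthe ->.
  rewrite [RHS](all_nth_iota 0) szs; apply: eq_in_all => j /nthe ->.
  congr (_ || _); first by rewrite /e nth_rcons szs ltnn eqxx.
  rewrite -has_pred1 [RHS](has_nth_iota 0) szs; apply: eq_in_has => k /nthe -> /=.
  exact: eq_sym.
have le i : i \in iota 0 n -> linear_term n (fun s f => e s f i).
  by rewrite mem_iota => /ltnW; apply: linear_term_nth.
apply: definable_and.
  apply: definable_all => i; rewrite mem_iota add0n ltnS => /= ilt.
  apply: definable_lt; last exact: linear_term_nth.
  case: i ilt => [|i] ilt; first exact: linear_term0.
  exact: linear_term_nth (ltnW ilt).
apply: definable_all => i /le Li; apply: definable_all => j /le Lj.
apply: definable_or.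
  by apply: definable_lt; [apply: linear_term_nth|apply: linear_termD].
apply: definable_has => k /le Lk.
by apply: definable_eq => //; apply: linear_termD.
Qed.

Lemma quasipoly_count_admissible n : exists2 Q, quasipoly Q & forall f, 0 < f ->
  ((count (admissible f) (words n f))%:R = Q f%:Z)%R.
Proof.
have [G pG HG] := definable_admissible n.
have [Q qQ HQ] := pwq_sum_words pG; exists Q => // f f0; rewrite -HQ //.
rewrite -sum1_count natr_sum big_mkcond /=; apply: eq_big_seq => s.
by rewrite mem_words => /andP[/eqP szs _]; rewrite HG //; case: admissible.
Qed.

Definition semigroup_of (f : nat) (s : seq nat) : set nat :=
  [set m | m = 0 \/ m \in s \/ f < m].

Lemma increasing_rcons b f s : path ltn b (rcons s f) ->
  [/\ sorted ltn s, b < f & forall a, a \in s -> b < a < f].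
Proof.
move=> inc; have : sorted ltn (b :: rcons s f) by [].
rewrite (sorted_pairwise ltn_trans) /= all_rcons pairwise_rcons.
case/andP=> /andP[bf /allP bs] /andP[/allP sf ps]; split=> //.
  by rewrite (sorted_pairwise ltn_trans).
by move=> a as_; apply/andP; split; [exact: bs|exact: sf].
Qed.

Lemma frobenius_semigroup_of f s :
  admissible f s -> frobenius_number (semigroup_of f s) f.
Proof.
move=> /andP[/increasing_rcons[_ f0 lts] _]; split.
  case=> [f00|[/lts|]]; [by rewrite f00 in f0|by rewrite ltnn andbF|by rewrite ltnn].
by move=> m nm; rewrite leqNgt; apply/negP => fm; apply: nm; right; right.
Qed.

Lemma frobenius_unique S f g :
  frobenius_number S f -> frobenius_number S g -> f = g.
Proof.
move=> [Sf maxf] [Sg maxg]; apply/eqP.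
by rewrite eqn_leq maxg // maxf.
Qed.

Lemma sporadicE S f : frobenius_number S f ->
  sporadic S = [set m | S m /\ m < f].
Proof.
move=> Sf; apply/seteqP; split=> m /=.
  by case=> Sm [g Sg mg]; rewrite (frobenius_unique Sf Sg).
by case=> Sm mf; split=> //; exists f.
Qed.

Lemma card_eq_seq (T : eqType) (s : seq T) : uniq s -> [set` s] #= `I_(size s).
Proof.
case: s => [|x0 s'] us.
  rewrite (_ : [set` _] = set0) ?II0 ?card_eqxx //.
  by apply/seteqP; split.
set s := x0 :: s' in us *.
rewrite (_ : [set` s] = nth x0 s @` `I_(size s)).
  apply: inj_card_eq => i j /set_mem /= iL /set_mem /= jL /eqP.
  by rewrite nth_uniq // => /eqP.
apply/seteqP; split=> x /=; first by case/(nthP x0) => i lt <-; exists i.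
by case=> i lt <-; apply: mem_nth.
Qed.

Lemma sporadic_semigroup_of f s :
  admissible f s -> sporadic (semigroup_of f s) = [set` 0 :: s].
Proof.
move=> adm; rewrite (sporadicE (frobenius_semigroup_of adm)).
have /andP[/increasing_rcons[_ f0 lts] _] := adm.
apply/seteqP; split=> m /=; rewrite inE.
  case=> [[->|[->|fm]] mf]; rewrite ?eqxx ?orbT //.
  by move: (ltn_trans fm mf); rewrite ltnn.
by case/orP=> [/eqP ->|ms]; split; [left| |right; left|case/andP: (lts m ms)].
Qed.

Lemma numerical_semigroup_of f s :
  admissible f s -> numerical_semigroup (semigroup_of f s).
Proof.
move=> /andP[/increasing_rcons[_ f0 lts] /allP sums]; split.
- by left.
- move=> a b [->|[as_|fa]]; first by rewrite add0n.
    case=> [->|[bs|fb]]; first by rewrite addn0; right; left.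
      have /allP/(_ b bs)/orP[lt|mem] := sums a as_; first by right; right.
      by right; left.
    by right; right; apply: ltn_addl.
  by move=> _; right; right; apply: ltn_addr.
- apply: (@sub_finite_set _ _ `I_f.+1); last exact: finite_II.
  by move=> m nm /=; rewrite ltnS leqNgt; apply/negP => fm; apply: nm; right; right.
Qed.

Lemma semigroup_of_inj f s t : admissible f s -> admissible f t ->
  semigroup_of f s = semigroup_of f t -> s = t.
Proof.
have sub u v : admissible f u -> admissible f v ->
    semigroup_of f u = semigroup_of f v -> {subset u <= v}.
  move=> /andP[/increasing_rcons[_ _ ltu] _] _ E a au.
  have [a0 af] := andP (ltu a au).
  have : semigroup_of f v a by rewrite -E; right; left.
  case=> [a00|[//|fa]]; first by rewrite a00 in a0.
  by move: (ltn_trans fa af); rewrite ltnn.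
move=> as_ at_ E.
have /andP[/increasing_rcons[ss _ _] _] := as_.
have /andP[/increasing_rcons[st _ _] _] := at_.
apply: (irr_sorted_eq ltn_trans ltnn ss st) => a.
by apply/idP/idP; apply: sub.
Qed.

(** The positive sporadic elements, listed in increasing order, are admissible:
    a sum of two of them lies in the semigroup, hence differs from [f], and is
    itself sporadic unless it exceeds [f]. *)
Lemma semigroups_withE n f : 0 < f -> semigroups_with n.+1 f =
  semigroup_of f @` [set` [seq s <- words n f | admissible f s]].
Proof.
move=> f0; apply/seteqP; split=> [S [[S0 SD fin] Sf card]|_ [s /= + <-]]; last first.
  rewrite mem_filter mem_words => /and3P[adm /eqP szs _]; split.
  - exact: numerical_semigroup_of.
  - exact: frobenius_semigroup_of.
  - rewrite sporadic_semigroup_of // -szs -[(size s).+1]/(size (0 :: s)).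
    apply: card_eq_seq => /=.
    have /andP[/increasing_rcons[ss _ lts] _] := adm.
    rewrite (sorted_uniq ltn_trans ltnn ss) andbT.
    by apply/negP => /lts.
have [nSf maxS] := Sf.
pose s := [seq a <- iota 1 f.-1 | `[< S a >]].
have mems a : (a \in s) = `[< S a >] && (0 < a < f).
  by rewrite mem_filter mem_iota add1n prednK.
have srt : path ltn 0 (rcons s f).
  have sub : subseq (0 :: rcons s f) (iota 0 f.+1).
    have -> : iota 0 f.+1 = 0 :: (iota 1 f.-1 ++ [:: f]).
      rewrite -[in LHS](prednK f0) -[f.-1.+1 in LHS]addn1 [LHS]/= iotaD add1n.
      by rewrite prednK.
    rewrite -cats1 -!cat_cons cat_subseq //= ?eqxx //; apply: filter_subseq.
  exact: (subseq_sorted ltn_trans sub (iota_ltn_sorted 0 f.+1)).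
have adm : admissible f s.
  rewrite /admissible srt; apply/allP => a; rewrite mems => /andP[/asboolP Sa /andP[a0 _]].
  apply/allP => b; rewrite mems => /andP[/asboolP Sb _].
  have Sab := SD _ _ Sa Sb.
  have [//|abf|abf] := ltngtP f (a + b); last by rewrite abf in nSf.
  by rewrite mems abf addn_gt0 a0 !andbT /=; apply/asboolP.
have SE : semigroup_of f s = S.
  apply/seteqP; split=> m.
    case=> [->//|[|fm]]; first by rewrite mems => /andP[/asboolP].
    apply: contrapT => /maxS; by rewrite leqNgt fm.
  move=> Sm; case: (posnP m) => m0; first by left.
  right; case: (ltngtP m f) => mf; [left|by right|by rewrite mf in Sm].
  by rewrite mems m0 mf !andbT; apply/asboolP.
exists s => //=; rewrite mem_filter adm mem_words /=; apply/andP; split.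
  have us : uniq (0 :: s).
    rewrite /= mems ltnn andbF /=; apply: filter_uniq; exact: iota_uniq.
  move: card; rewrite -SE sporadic_semigroup_of // => card.
  have := card_eq_trans (card_esym (card_eq_seq us)) card.
  by move=> /card_eq_II [->].
by apply/allP => a; rewrite mems => /and3P[_ _ /ltnW].
Qed.

Lemma card_semigroups_with n f : 0 < f ->
  semigroups_with n.+1 f #= `I_(count (admissible f) (words n f)).
Proof.
move=> f0; rewrite semigroups_withE // -size_filter.
have us := filter_uniq (admissible f) (words_uniq n f).
apply: card_eq_trans (card_eq_seq us).
apply: inj_card_eq => s t /set_mem /=; rewrite mem_filter => /andP[as_ _].
by move=> /set_mem /=; rewrite mem_filter => /andP[at_ _]; apply: semigroup_of_inj.
Qed.

(** * Size of the count *)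

Lemma size_words n f : size (words n f) = f.+1 ^ n.
Proof. by elim: n => // n IH; rewrite wordsS size_allpairs size_iota IH expnS. Qed.

Lemma count_words_cons n f (p : pred (seq nat)) :
  count p (words n.+1 f)
  = \sum_(x <- iota 0 f.+1) count (fun t => p (x :: t)) (words n f).
Proof.
rewrite -sum1_count big_mkcond big_allpairs_dep; apply: eq_bigr => x _.
by rewrite -big_mkcond sum1_count.
Qed.

(** Pascal's rule: the first entry of an increasing sequence above [b] is either
    [b.+1] or larger. *)
Lemma count_increasing n f b : b < f ->
  count (fun s => path ltn b (rcons s f)) (words n f) = 'C(f - b.+1, n).
Proof.
elim: n b => [|n IH] b bf; first by rewrite /= bf bin0.
rewrite count_words_cons.
rewrite (eq_bigr (fun x => (b < x) * count (fun t => path ltn x (rcons t f)) (words n f))); last first.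
  move=> x _ /=; case: (b < x) => /=; first by rewrite mul1n.
  by rewrite mul0n (eq_count (a2 := pred0)) ?count_pred0.
have last0 : count (fun t => path ltn f (rcons t f)) (words n f) = 0.
  rewrite (eq_count (a2 := pred0)) ?count_pred0 // => t.
  by apply/negP => /increasing_rcons[_]; rewrite ltnn.
have [d fb] : exists d, f - b.+1 = d by exists (f - b.+1).
elim: d b bf fb => [|d IHd] b bf fb.
  rewrite fb bin0n big_seq big1 // => x; rewrite (mem_iota 0 f.+1) add0n ltnS.
  move=> /= xf; have [bx|] := ltnP b x; last by [].
  by rewrite (_ : x = f) ?last0 ?muln0 //; lia.
have bf' : b.+1 < f by lia.
have fb' : f - b.+2 = d by lia.
have := IHd b.+1 bf' fb'; rewrite fb' fb binS => <-.
rewrite -[in X in _ = _ + X]fb' -IH //.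
have bmem : b.+1 \in iota 0 f.+1 by rewrite mem_iota; lia.
rewrite !(bigD1_seq _ bmem (iota_uniq 0 f.+1)) /= ltnn ltnSn mul0n mul1n add0n addnC.
congr (_ + _); apply: eq_bigr => x xb; congr (_ * _); lia.
Qed.

Definition has_double (s : seq nat) : bool :=
  ~~ pairwise (fun x y => y != x.*2) s.

(** One entry of such a word is determined by another one and the positions of
    the two, which saves a factor [f.+1] out of [f.+1 ^ n].  The factor is kept
    on the left to avoid the exponent [n - 1]. *)
Lemma count_has_double n f :
  f.+1 * count has_double (words n f) <= n ^ 2 * f.+1 ^ n.
Proof.
elim: n => [|n IH]; first by rewrite muln0.
rewrite count_words_cons.
have step : \sum_(x <- iota 0 f.+1) count (fun t => has_double (x :: t)) (words n f)
    <= n * f.+1 ^ n + f.+1 * count has_double (words n f).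
  apply: (@leq_trans (\sum_(x <- iota 0 f.+1) (count (fun t => x.*2 \in t) (words n f)
     + count has_double (words n f)))).
    apply: leq_sum => x _; rewrite -count_predUI.
    apply: leq_trans (leq_addr _ _); apply: sub_count => t /=.
    rewrite /has_double /= negb_and => /orP[|->]; last by rewrite orbT.
    by rewrite -has_predC => /hasP[y yt] /=; rewrite negbK => /eqP <-; rewrite yt.
  rewrite big_split /=; apply: leq_add; last first.
    by rewrite big_const_seq count_predT (size_iota 0 f.+1) iter_addn_0 mulnC.
  under eq_bigr => x _ do rewrite -sum1_count big_mkcond.
  rewrite exchange_big /= -size_words mulnC -sum1_size big_distrl /=.
  rewrite big_seq [X in _ <= X]big_seq; apply: leq_sum => t.
  rewrite mem_words mul1n => /andP[/eqP <- _].
  rewrite -big_mkcond sum1_count -size_filter -(size_map double).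
  apply: uniq_leq_size.
    rewrite map_inj_uniq; first exact: filter_uniq (iota_uniq 0 f.+1).
    by move=> x y; lia.
  by move=> y /mapP[x]; rewrite mem_filter => /andP[+ _] ->.
apply: leq_trans (leq_mul (leqnn _) step) _.
rewrite (expnS f.+1) mulnCA leq_mul2l /=.
apply: (@leq_trans (n * f.+1 ^ n + n ^ 2 * f.+1 ^ n)); first by rewrite leq_add2l.
by rewrite -mulnDl leq_mul2r; apply/orP; right; lia.
Qed.

(** If the smallest entry [a] of an admissible sequence is at most [f / 2], then
    [a + a] does not exceed [f], so that it has to be an entry. *)
Lemma count_admissible_bounds n f : 0 < f ->
  'C(f - f./2.+1, n) <= count (admissible f) (words n f)
    <= 'C(f - f./2.+1, n) + count has_double (words n f).
Proof.
move=> f0; have hf : f./2 < f by lia.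
rewrite -count_increasing //; apply/andP; split.
  apply: sub_count => s /= inc; have [_ _ lts] := increasing_rcons inc.
  apply/andP; split; last first.
    apply/allP => a /lts as_; apply/allP => b /lts bs; lia.
  case: s inc {lts} => [|a s] /=; first by rewrite f0.
  by case/andP=> h ->; rewrite andbT; lia.
rewrite -count_predUI; apply: leq_trans (leq_addr _ _).
apply: sub_count => -[|a s]; first by rewrite /= hf.
rewrite /admissible /= => /andP[/andP[a0 inc] /andP[/andP[aa _] _]].
have [ha|ha] := ltnP f./2 a; first by rewrite inc.
have -> : has_double (a :: s); last by rewrite orbT.
rewrite /has_double /= negb_and -has_predC; apply/orP; left.
move: aa; rewrite inE; have -> : (f < a + a) = false by lia.
have -> : (a + a == a) = false by lia.
rewrite /= => mem; apply/hasP; exists (a + a) => //=.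
by rewrite negbK addnn.
Qed.

Local Open Scope ring_scope.

(** Here [f - f./2.+1] is the number of integers strictly between [f / 2] and
    [f]; its double is [f - 1] or [f - 2], and each factor of the falling
    factorial differs from [f / 2] by a bounded amount.  In this and the next
    lemmas [O(f ^ (n - 1))] is written as [f * _ <= M * f ^ n], which is also
    meaningful for [n = 0]. *)
Lemma ffact_asymptotics (n f : nat) : (0 < f)%N ->
  f%:R * `|2 ^+ n * ((f - f./2.+1) ^_ n)%N%:R - f%:R ^+ n|
    <= (n * n.+1)%N%:R * f%:R ^+ n :> rat.
Proof.
move=> f0; set m := (f - f./2.+1)%N.
have m2 : (m.*2 < f)%N by rewrite /m; lia.
have f2 : (f <= m.*2 + 2)%N by rewrite /m; lia.
pose D k : rat := 2 ^+ k * (m ^_ k)%N%:R.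
have D0 k : 0 <= D k by rewrite mulr_ge0 ?exprn_ge0.
have DS k : D k.+1 = D k * (f%:R - (f%:R - (m.*2)%:R + (k.*2)%:R)).
  rewrite /D ffactnSr exprS natrM -[m.*2]muln2 -[k.*2]muln2 !natrM.
  have [km|mk] := leqP k m; first by rewrite natrB //; ring.
  by rewrite ffact_small // !(mulr0, mul0r).
have Df k : D k <= f%:R ^+ k.
  elim: k => [|k IH]; first by rewrite /D ffactn0 mul1r.
  rewrite DS exprSr; apply: (@le_trans _ _ (D k * f%:R)).
    apply: ler_wpM2l => //; rewrite gerDl oppr_le0 addr_ge0 // subr_ge0 ler_nat; lia.
  by apply: ler_wpM2r.
have eb k : 0 <= (f%:R : rat) - (m.*2)%:R + (k.*2)%:R <= (k.+1.*2)%:R.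
  rewrite addr_ge0 ?subr_ge0 ?ler_nat //=; last by lia.
  by rewrite addrAC lerBlDr -!natrD ler_nat; lia.
elim: n => [|k IH]; first by rewrite ffactn0 mul1r subrr normr0 mulr0 mul0r.
rewrite -/(D k) in IH; rewrite -/(D k.+1) DS; set e := _ + (k.*2)%:R.
have -> : D k * (f%:R - e) - f%:R ^+ k.+1 = f%:R * (D k - f%:R ^+ k) - e * D k.
  by rewrite exprS; ring.
have fk : 0 <= f%:R :> rat by [].
apply: (@le_trans _ _ (f%:R * (f%:R * `|D k - f%:R ^+ k| + (k.+1.*2)%:R * f%:R ^+ k))).
  apply: ler_wpM2l => //; apply: (le_trans (ler_normB _ _)); apply: lerD.
    by rewrite normrM ger0_norm.
  have /andP[e0 e2] := eb k.
  by rewrite normrM !ger0_norm //; apply: ler_pM.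
have -> : (k.+1 * k.+2)%N%:R * f%:R ^+ k.+1 =
  f%:R * ((k * k.+1)%N%:R * f%:R ^+ k + (k.+1.*2)%:R * f%:R ^+ k) :> rat.
  rewrite exprS -mulrDl -natrD; have -> : (k * k.+1 + k.+1.*2 = k.+1 * k.+2)%N by lia.
  ring.
by apply: ler_wpM2l => //; apply: lerD.
Qed.

Lemma count_admissible_asymptotics (n : nat) : exists M : rat,
  forall f : nat, (0 < f)%N ->
    f%:R * `|(count (admissible f) (words n f))%:R
             - 1 / (2 ^+ n * (n`!)%:R) * f%:R ^+ n| <= M * f%:R ^+ n.
Proof.
pose c : rat := 1 / (2 ^+ n * (n`!)%:R).
have cpos : 0 < 2 ^+ n * (n`!)%:R :> rat by rewrite mulr_gt0 ?exprn_gt0 ?ltr0n ?fact_gt0.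
exists ((n * n.+1)%N%:R * c + (n ^ 2 * 2 ^ n)%N%:R) => f f0.
have /andP[lo hi] := count_admissible_bounds n f0.
have bad := count_has_double n f.
set N := count _ _ in lo hi *; set B := count _ _ in hi bad; set b := 'C(_, _) in lo hi.
have -> : N%:R = b%:R + (N - b)%N%:R :> rat by rewrite -natrD subnKC.
have pow k : (f.+1 ^ k <= (2 * f) ^ k)%N.
  by elim: k => // k IH; rewrite !expnS leq_mul //; lia.
have eB : (f * (N - b) <= n ^ 2 * 2 ^ n * f ^ n)%N.
  apply: (@leq_trans (f.+1 * B)); first by apply: leq_mul => //; lia.
  apply: (leq_trans bad); rewrite -mulnA leq_mul2l -expnMn pow orbT //.
rewrite -/c; have -> : b%:R + (N - b)%N%:R - c * f%:R ^+ n =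
    c * (2 ^+ n * ((f - f./2.+1) ^_ n)%N%:R - f%:R ^+ n) + (N - b)%N%:R.
  rewrite -bin_ffact -/b natrM /c; field.
  by rewrite expf_neq0 // pnatr_eq0 -lt0n fact_gt0.
apply: (@le_trans _ _ (f%:R * (`|c * (2 ^+ n * ((f - f./2.+1) ^_ n)%N%:R - f%:R ^+ n)|
     + (N - b)%N%:R))).
  by apply: ler_wpM2l => //; apply: (le_trans (ler_normD _ _)); rewrite normr_nat.
have c0 : 0 < c by rewrite /c divr_gt0.
move: c c0 => c c0.
rewrite mulrDr mulrDl; apply: lerD; last by rewrite -natrX -!natrM ler_nat.
rewrite normrM (ger0_norm (ltW c0)) mulrCA [(n * n.+1)%N%:R * c]mulrC -mulrA ler_pM2l //.
exact: ffact_asymptotics.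
Qed.

(** A polynomial of degree [d >= n] eventually dominates a multiple of [x ^ d],
    which contradicts the bound of order [x ^ (n - 1)] on an unbounded set. *)
Lemma size_poly_growth (g : {poly rat}) (n : nat) (M : rat) :
  (forall B : nat, exists2 x : nat, (B < x)%N &
    x%:R * `|g.[x%:R]| <= M * x%:R ^+ n) ->
  (size g <= n)%N.
Proof.
move=> growth; rewrite leqNgt; apply/negP => ng.
pose d := (size g).-1; have szg : size g = d.+1 by rewrite prednK //; lia.
have a0 : 0 < `|g`_d|.
  by rewrite normr_gt0 -/(lead_coef g) lead_coef_eq0 -size_poly_eq0 szg.
pose S := \sum_(i < d) `|g`_i|.
have [x Bx gx] := growth (Num.bound ((`|M| + S) / `|g`_d|)).
have S0 : 0 <= S by apply: sumr_ge0.
have x1 : 1 <= x%:R :> rat by rewrite ler1n; lia.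
have : (`|M| + S) / `|g`_d| < x%:R.
  apply: (lt_le_trans (archi_boundP _)); last by rewrite ler_nat ltnW.
  by rewrite divr_ge0 ?addr_ge0 // ltW.
rewrite ltr_pdivrMr // ltNge => /negP; apply.
have xd : 0 < x%:R ^+ d :> rat by rewrite exprn_gt0 // ltr0n; lia.
rewrite -(ler_pM2r xd).
have E : g`_d * x%:R ^+ d = g.[x%:R] - \sum_(i < d) g`_i * x%:R ^+ i.
  by rewrite horner_coef szg big_ord_recr /= addrC addrK.
rewrite -mulrA -{1}(ger0_norm (ltW xd)) -normrM E.
apply: (@le_trans _ _ (x%:R * `|g.[x%:R]| + x%:R * `|\sum_(i < d) g`_i * x%:R ^+ i|)).
  by rewrite -mulrDr; apply: ler_wpM2l => //; apply: ler_normB.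
rewrite mulrDl; apply: lerD.
  apply: (le_trans gx); apply: (@le_trans _ _ (`|M| * x%:R ^+ n)).
    by apply: ler_wpM2r; rewrite ?exprn_ge0 ?ler_norm.
  by apply: ler_wpM2l => //; apply: ler_weXn2l => //; lia.
rewrite mulr_suml; apply: (@le_trans _ _ (x%:R * \sum_(i < d) `|g`_i * x%:R ^+ i|)).
  by apply: ler_wpM2l => //; apply: ler_norm_sum.
rewrite mulr_sumr; apply: ler_sum => i _.
rewrite normrM mulrCA; apply: ler_wpM2l => //.
rewrite ger0_norm ?exprn_ge0 // -exprS; apply: ler_weXn2l => //.
Qed.

Close Scope ring_scope.

Theorem corollary2 (n : nat) :
  exists N : nat -> nat,
    (forall f : nat, 0 < f -> semigroups_with n.+1 f #= `I_(N f)) /\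
    exists (q : int -> rat) (K : nat) (p : 'I_K -> {poly rat}),
      [/\ agrees_on_positive N q,
          quasi_polynomial_by p q,
          quasi_degree p = n
        & forall r : 'I_K, ((p r)`_n = 1 / (2 ^+ n * (n`!)%:R))%R].
Proof.
exists (fun f => count (admissible f) (words n f)).
split; first by move=> f; apply: card_semigroups_with.
have [Q [K K0 [p pper Qp]] HQ] := quasipoly_count_admissible n.
pose c : rat := (1 / (2 ^+ n * (n`!)%:R))%R.
have c0 : (c != 0)%R.
  by rewrite /c mul1r invr_neq0 // mulf_neq0 ?expf_neq0 // pnatr_eq0 -lt0n fact_gt0.
have [M HM] := count_admissible_asymptotics n.
have szg (r : int) : size (p r - c *: 'X^n)%R <= n.
  apply: (@size_poly_growth _ _ M) => B.
  pose z : int := (r + (`|r| + B.+1)%N%:Z * K%:Z)%R.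
  have zB : (B%:Z < z)%R by rewrite /z; nia.
  have [x zx] : exists x : nat, z = Posz x by exists `|z|%N; lia.
  have pz : p (Posz x) = p r by rewrite -zx /z periodicMz.
  have x0 : (B < x)%N by rewrite -ltz_nat -zx.
  exists x => //; have := HM x (leq_ltn_trans (leq0n B) x0).
  by rewrite HQ ?(leq_ltn_trans (leq0n B) x0) // Qp pz -/c !hornerE.
have coefp r : ((p r)`_n = c)%R.
  have /leq_sizeP/(_ n (leqnn n)) := szg r.
  by rewrite coefB coefZ coefXn eqxx mulr1 => /eqP; rewrite subr_eq0 => /eqP.
have szp r : size (p r) = n.+1.
  apply/eqP; rewrite eqn_leq; apply/andP; split; last first.
    by rewrite ltnNge; apply/negP => /leq_sizeP/(_ n (leqnn n))/eqP; rewrite coefp (negbTE c0).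
  rewrite -(subrK (c *: 'X^n) (p r))%R.
  apply: leq_trans (size_polyD _ _) _; rewrite geq_max (leqW (szg r)).
  by apply: leq_trans (size_scale_leq _ _) _; rewrite size_polyXn.
exists Q, K, (fun r : 'I_K => p (Posz r)); split=> //.
- split=> // r m E; rewrite Qp; congr (_.[_])%R; exact: periodic_eqmod pper E.
- rewrite /quasi_degree; apply/eqP; rewrite eqn_leq; apply/andP; split.
    by apply/bigmax_leqP => r _; rewrite szp.
  by apply: leq_trans (leq_bigmax (Ordinal K0)); rewrite szp.
Qed.
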